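(* Let $T>0$, $Q>0$, and let $\theta,\eta:[0,T]\to(0,\infty)$ be continuously differentiable. Let the permanent impact $\theta$ be decreasing and the temporary impact $\eta$ be increasing. Let $\bar\eta=\min_{0\le t\le T}\eta_t$, $\bar\theta=\max_{0\le t\le T}\max\{-\dot\theta_t,0\}$, $\gamma=\frac{\bar\theta}{2\bar\eta}$. Assume $\sqrt{\gamma}\,T<\pi$ and that there is a unique solution to the boundary value problem $$2\eta_t\ddot\zeta_t+2\dot\eta_t\dot\zeta_t-\dot\theta_t\zeta_t=0,\qquad \zeta_0=Q,\qquad \zeta_T=0 .$$ Then the Optimal Execution Problem of maximizing $\mathcal{J}$ over $\Xi(Q)$ has a unique solution, which is non-negative and is either decreasing or has one turning point.
   Context: $\Xi(Q)=\{\zeta\in\mathcal{C}^2([0,T]):\ \zeta_0=Q,\ \zeta_T=0\}$ and $$\mathcal{J}(\zeta)=\int_0^T\left(\theta_t\,\dot\zeta_t\,\zeta_t-\eta_t\,\dot\zeta_t^2\right)dt .$$ ''Increasing'' and ''decreasing'' mean non-decreasing and non-increasing. ''One turning point'' means that $\dot\zeta$ changes sign exactly once on $[0,T]$. *)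

(* Defs.v *)
From Stdlib Require Import Reals.
From Coquelicot Require Import Coquelicot.
Open Scope R_scope.

(* Functions on [a, b] are represented by total functions [R -> R] whose values
   outside [a, b] are irrelevant: every notion below only looks at [Icc a b], and
   two such functions are identified when they agree on [Icc a b]. *)
Definition Icc (a b : R) : R -> Prop := fun t => a <= t <= b.

(* The limit is taken within [a, b], so it is one-sided at a and b. *)
Definition is_derive_on (a b : R) (f : R -> R) (t l : R) : Prop :=
  filterlim (fun s => (f s - f t) / (s - t))
    (within (Icc a b) (locally' t)) (locally l).

(* Only meaningful when the derivative exists, a < b and t is in [a, b]. *)
Definition Derive_on (a b : R) (f : R -> R) (t : R) : R :=
  iota (fun l : R => is_derive_on a b f t l).

Definition C1_on (a b : R) (f : R -> R) : Prop :=
  (forall t, Icc a b t -> exists l, is_derive_on a b f t l) /\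
  continuous_on (Icc a b) (Derive_on a b f).

Definition C2_on (a b : R) (f : R -> R) : Prop :=
  C1_on a b f /\ C1_on a b (Derive_on a b f).

Definition increasing_on (a b : R) (f : R -> R) : Prop :=
  forall s t, Icc a b s -> Icc a b t -> s <= t -> f s <= f t.

Definition decreasing_on (a b : R) (f : R -> R) : Prop :=
  forall s t, Icc a b s -> Icc a b t -> s <= t -> f t <= f s.

Definition is_min_on (a b : R) (f : R -> R) (m : R) : Prop :=
  (exists t, Icc a b t /\ f t = m) /\ (forall t, Icc a b t -> m <= f t).

Definition is_max_on (a b : R) (f : R -> R) (m : R) : Prop :=
  (exists t, Icc a b t /\ f t = m) /\ (forall t, Icc a b t -> f t <= m).

(* The number of sign changes is the largest k for which there are points
   t_0 < ... < t_k in [a, b] with f(t_i) f(t_(i+1)) < 0 for all i < k (zeros of f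
   are disregarded); this says that the number is 1. *)
Definition changes_sign_exactly_once (a b : R) (f : R -> R) : Prop :=
  (exists s t, Icc a b s /\ Icc a b t /\ s < t /\ f s * f t < 0) /\
  ~ (exists s t u, Icc a b s /\ Icc a b t /\ Icc a b u /\ s < t < u /\
       f s * f t < 0 /\ f t * f u < 0).

Definition one_turning_point (a b : R) (z : R -> R) : Prop :=
  changes_sign_exactly_once a b (Derive_on a b z).

Definition unique_solution_on (a b : R) (P : (R -> R) -> Prop) (z : R -> R) :
    Prop :=
  P z /\ (forall y, P y -> forall t, Icc a b t -> y t = z t).

Definition Xi (T Q : R) (z : R -> R) : Prop :=
  C2_on 0 T z /\ z 0 = Q /\ z T = 0.

Definition J (T : R) (theta eta z : R -> R) : R :=
  RInt (fun t => theta t * Derive_on 0 T z t * z t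
                 - eta t * (Derive_on 0 T z t) ^ 2) 0 T.

Definition solves_execution (T Q : R) (theta eta z : R -> R) : Prop :=
  Xi T Q z /\ (forall y, Xi T Q y -> J T theta eta y <= J T theta eta z).

Definition solves_BVP (T Q : R) (theta eta z : R -> R) : Prop :=
  C2_on 0 T z /\
  (forall t, Icc 0 T t ->
     2 * eta t * Derive_on 0 T (Derive_on 0 T z) t
     + 2 * Derive_on 0 T eta t * Derive_on 0 T z t
     - Derive_on 0 T theta t * z t = 0) /\
  z 0 = Q /\ z T = 0.

(* Main.v *)
(** After an integration by parts, [J] is a constant plus the quadratic
    functional [- int (eta zeta'^2 + theta'/2 zeta^2)], whose Euler-Lagrange
    equation is the boundary value problem.  Hence, for the solution [z] of that
    problem and an admissible [y], the difference [J z - J y] is the integral of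
    [eta h'^2 + theta'/2 h^2] with [h = y - z].  This is at least
    [etabar * int (h'^2 - gamma h^2)], and with [w] the logarithmic derivative
    of [cos (sqrt gamma (t - T/2))], which is positive on [[0, T]] as
    [sqrt gamma T < PI], Jacobi's completion of squares gives
    [h'^2 - gamma h^2 = (h' - w h)^2 + (w h^2)'].  So [z] is the unique
    maximizer.  The same positivity on [[s, T]] shows that [z] vanishes after its
    first zero [s], so [z >= 0]; then [(eta z')' = theta' z / 2 <= 0], so [z']
    changes sign at most once, from positive to negative. *)
Require Import Defs.
From Stdlib Require Import Reals Lra.
From Coquelicot Require Import Coquelicot.
Open Scope R_scope.

(** * Derivatives within a closed interval *)

Lemma Icc_accumulation (a b t : R) (d : posreal) :
  a < b -> Icc a b t -> exists s, Icc a b s /\ s <> t /\ Rabs (s - t) < d.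
Proof.
  intros hab [h1 h2]. assert (hd := cond_pos d). unfold Icc.
  destruct (Rlt_dec t b) as [h|h].
  - assert (hm : 0 < Rmin (d / 2) (b - t)) by (apply Rmin_pos; lra).
    assert (h3 := Rmin_l (d / 2) (b - t)).
    assert (h4 := Rmin_r (d / 2) (b - t)).
    exists (t + Rmin (d / 2) (b - t)). repeat split; try lra.
    rewrite Rabs_right; lra.
  - assert (hm : 0 < Rmin (d / 2) (t - a)) by (apply Rmin_pos; lra).
    assert (h3 := Rmin_l (d / 2) (t - a)).
    assert (h4 := Rmin_r (d / 2) (t - a)).
    exists (t - Rmin (d / 2) (t - a)). repeat split; try lra.
    rewrite Rabs_left; lra.
Qed.

(** Every point of a nondegenerate interval, endpoints included, is an accumulation point.
    Properness makes derivatives within [Icc a b] unique and lets weak inequalities pass to the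
    limit. *)
Lemma within_Icc_proper (a b t : R) :
  a < b -> Icc a b t -> ProperFilter' (within (Icc a b) (locally' t)).
Proof.
  intros hab ht. constructor.
  - intros [d hd]. destruct (Icc_accumulation a b t d hab ht) as (s & h1 & h2 & h3).
    exact (hd s h3 h2 h1).
  - apply within_filter, within_filter, locally_filter.
Qed.

Lemma Derive_on_correct (a b : R) (f : R -> R) (t : R) :
  a < b -> Icc a b t -> (exists l, is_derive_on a b f t l) ->
  is_derive_on a b f t (Derive_on a b f t).
Proof.
  intros hab ht [l hl].
  apply (iota_correct (V := R_CompleteNormedModule)
           (fun l : R => is_derive_on a b f t l)).
  exists l. split; [exact hl|]. intros l' hl'.
  exact (filterlim_locally_unique (V := R_NormedModule)
           (FF := within_Icc_proper a b t hab ht) _ l l' hl hl').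
Qed.

(** Clearing the denominator gives an estimate that also covers [s = t], a point excluded from the
    difference quotient. *)
Lemma is_derive_on_eps (a b : R) (f : R -> R) (t l : R) (eps : posreal) :
  is_derive_on a b f t l ->
  exists d : posreal, forall s, Icc a b s -> Rabs (s - t) < d ->
    Rabs (f s - f t - l * (s - t)) <= eps * Rabs (s - t).
Proof.
  intros h.
  destruct (h (ball l eps) (locally_ball l eps)) as [d hd].
  exists d. intros s hs hst.
  destruct (Req_dec s t) as [->|hne].
  - replace (f t - f t - l * (t - t)) with 0 by ring.
    rewrite Rminus_diag, Rabs_R0. lra.
  - assert (h1 : Rabs ((f s - f t) / (s - t) - l) < eps) by exact (hd s hst hne hs).
    replace (f s - f t - l * (s - t))
      with (((f s - f t) / (s - t) - l) * (s - t)) by (field; lra).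
    rewrite Rabs_mult. apply Rmult_le_compat_r; [apply Rabs_pos|lra].
Qed.

Lemma Derive_on_decreasing_le (a b : R) (f : R -> R) (t : R) :
  a < b -> Icc a b t -> (exists l, is_derive_on a b f t l) ->
  decreasing_on a b f -> Derive_on a b f t <= 0.
Proof.
  intros hab ht hex hdec.
  assert (hl := Derive_on_correct a b f t hab ht hex).
  refine (filterlim_le (FF := within_Icc_proper a b t hab ht)
            _ (fun _ => 0) (Finite _) (Finite 0) _ hl (filterlim_const 0)).
  exists (mkposreal 1 Rlt_0_1). intros s _ hne hs.
  destruct (Rlt_dec s t) as [hlt|hge].
  - assert (h := hdec s t hs ht ltac:(lra)).
    assert (hi : / (s - t) < 0) by (apply Rinv_lt_0_compat; lra).
    unfold Rdiv. nra.
  - assert (h := hdec t s ht hs ltac:(lra)).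
    assert (hi : 0 < / (s - t)) by (apply Rinv_0_lt_compat; lra).
    unfold Rdiv. nra.
Qed.

(** * Extension of continuously differentiable functions to the line *)

(** For [a <= b] this is the nearest-point projection onto the interval. *)
Definition clamp (a b t : R) : R := Rmax a (Rmin b t).

Lemma clamp_id (a b t : R) : Icc a b t -> clamp a b t = t.
Proof. intros [h1 h2]. unfold clamp. rewrite Rmin_right, Rmax_right; lra. Qed.

Lemma clamp_Icc (a b t : R) : a <= b -> Icc a b (clamp a b t).
Proof.
  intros h. unfold Icc, clamp, Rmax, Rmin.
  destruct (Rle_dec b t); destruct (Rle_dec a _); lra.
Qed.

(** The projection of [s] lies between [t] and [s], so an increment splits into a part inside the
    interval and an overshoot. *)
Lemma clamp_dist (a b s t : R) : Icc a b t ->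
  Rabs (clamp a b s - t) + Rabs (s - clamp a b s) = Rabs (s - t).
Proof.
  intros [h1 h2]. unfold clamp, Rmax, Rmin.
  destruct (Rle_dec b s); destruct (Rle_dec a _); unfold Rabs;
    repeat destruct Rcase_abs; lra.
Qed.

(* Extending [f] by its tangents at the two ends trades the one-sided notions of
   [C1_on] for ordinary derivatives. *)
Lemma C1_on_extension (a b : R) (f : R -> R) :
  a < b -> C1_on a b f ->
  exists F F' : R -> R, forall t, Icc a b t ->
    F t = f t /\ F' t = Derive_on a b f t /\
    is_derive F t (F' t) /\ continuous F' t.
Proof.
  intros hab [hex hcont].
  set (c := clamp a b). set (D := Derive_on a b f) in *.
  exists (fun t => f (c t) + D (c t) * (t - c t)), (fun t => D (c t)).
  intros t ht.
  assert (hct : c t = t) by exact (clamp_id a b t ht).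
  (* [D] composed with the projection is continuous at [t], because projecting does not increase the
     distance to [t]. *)
  assert (hD : forall eps : posreal, exists d : posreal, forall s,
             Rabs (s - t) < d -> Rabs (D (c s) - D t) < eps).
  { intros eps. destruct (hcont t ht (ball (D t) eps) (locally_ball _ _)) as [d hd].
    exists d. intros s hs.
    refine (hd (c s) _ (clamp_Icc a b s (Rlt_le _ _ hab))).
    assert (h1 := clamp_dist a b s t ht).
    assert (h2 := Rabs_pos (s - clamp a b s)).
    change (Rabs (clamp a b s - t) < d). lra. }
  split; [|split; [|split]].
  - rewrite hct. ring.
  - now rewrite hct.
  - rewrite hct. apply is_derive_Reals. intros eps heps.
    assert (hp : 0 < eps / 3) by lra.
    destruct (hD (mkposreal _ hp)) as [d1 hd1].
    destruct (is_derive_on_eps a b f t (D t) (mkposreal _ hp)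
                (Derive_on_correct a b f t hab ht (hex t ht))) as [d2 hd2].
    simpl in hd1, hd2.
    assert (hd : 0 < Rmin d1 d2) by (apply Rmin_pos; apply cond_pos).
    exists (mkposreal _ hd). simpl. intros h hne hh.
    assert (hr1 := Rmin_l d1 d2). assert (hr2 := Rmin_r d1 d2).
    set (s := t + h). assert (hs : s - t = h) by (unfold s; ring).
    assert (hdist := clamp_dist a b s t ht). fold c in hdist.
    assert (hA := Rabs_pos (c s - t)). assert (hB := Rabs_pos (s - c s)).
    rewrite hs in hdist.
    specialize (hd1 s ltac:(rewrite hs; lra)).
    specialize (hd2 (c s) (clamp_Icc a b s (Rlt_le _ _ hab)) ltac:(lra)).
    rewrite hct.
    (* The error is the linearization error at [c s] plus the slope change times the overshoot. As
       the two distances sum to [Rabs h], the total is at most [eps / 3 * Rabs h]. *)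
    replace ((f (c s) + D (c s) * (s - c s) - (f t + D t * (t - t))) / h - D t)
      with (((f (c s) - f t - D t * (c s - t))
             + (D (c s) - D t) * (s - c s)) / h)
      by (rewrite <- hs in *; field; exact hne).
    assert (hpos : 0 < Rabs h) by now apply Rabs_pos_lt.
    unfold Rdiv. rewrite Rabs_mult, Rabs_inv.
    apply Rmult_lt_reg_r with (1 := hpos).
    rewrite Rmult_assoc, Rinv_l, Rmult_1_r by lra.
    apply Rle_lt_trans with (1 := Rabs_triang _ _).
    rewrite Rabs_mult. nra.
  - apply filterlim_locally. intros eps. destruct (hD eps) as [d hd].
    exists d. intros s hs. rewrite hct. exact (hd s hs).
Qed.

(** * Continuity, integrals and monotonicity *)

Lemma continuous_Rplus (f g : R -> R) (t : R) :
  continuous f t -> continuous g t -> continuous (fun s => f s + g s) t.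
Proof. exact (continuous_plus (V := R_NormedModule) f g t). Qed.

Lemma continuous_Ropp (f : R -> R) (t : R) :
  continuous f t -> continuous (fun s => - f s) t.
Proof. exact (continuous_opp (V := R_NormedModule) f t). Qed.

Lemma continuous_Rmult (f g : R -> R) (t : R) :
  continuous f t -> continuous g t -> continuous (fun s => f s * g s) t.
Proof. exact (continuous_mult (K := R_AbsRing) f g t). Qed.

Lemma is_derive_continuous (f : R -> R) (t l : R) :
  is_derive f t l -> continuous f t.
Proof. intros h. apply (ex_derive_continuous f). now exists l. Qed.

(* [auto_derive] leaves the eta-expanded form. *)
Lemma Derive_eta_unique (f : R -> R) (t l : R) :
  is_derive f t l -> Derive (fun s : R => f s) t = l.
Proof. apply is_derive_unique. Qed.

Ltac solve_continuous :=
  cbn [pow]; unfold Rdiv, Rminus;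
  repeat first
    [ assumption
    | eapply is_derive_continuous; eassumption
    | apply continuous_const
    | apply continuous_Rplus
    | apply continuous_Ropp
    | apply continuous_Rmult ].

Lemma ex_RInt_continuous_le (f : R -> R) (a b : R) :
  a <= b -> (forall t, Icc a b t -> continuous f t) -> ex_RInt f a b.
Proof.
  intros hab h. apply (ex_RInt_continuous (V := R_CompleteNormedModule)).
  intros t. rewrite Rmin_left, Rmax_right by exact hab. apply h.
Qed.

Lemma RInt_is_derive (f df : R -> R) (a b : R) :
  a <= b -> (forall t, Icc a b t -> is_derive f t (df t)) ->
  (forall t, Icc a b t -> continuous df t) -> RInt df a b = f b - f a.
Proof.
  intros hab h1 h2. apply is_RInt_unique.
  apply (is_RInt_derive (V := R_CompleteNormedModule) f df);
    intros t; rewrite Rmin_left, Rmax_right by exact hab; [apply h1|apply h2].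
Qed.

Lemma decreasing_on_is_derive (a b : R) (f df : R -> R) :
  (forall t, Icc a b t -> is_derive f t (df t)) ->
  (forall t, Icc a b t -> df t <= 0) -> decreasing_on a b f.
Proof.
  intros hd hle s t [h1 h2] [h3 h4] hst.
  destruct (MVT_gen f s t df) as (c & hc & he);
    rewrite Rmin_left, Rmax_right in * by exact hst.
  - intros x hx. apply hd. split; lra.
  - intros x hx. apply continuity_pt_filterlim, (is_derive_continuous f x (df x)), hd.
    split; lra.
  - assert (h := hle c ltac:(split; lra)). nra.
Qed.

(** A positive value persists on a subinterval by continuity and contributes a positive amount,
    which the nonnegative remainder cannot cancel. *)
Lemma RInt_nonneg_eq_0 (f : R -> R) (a b : R) :
  a < b -> (forall t, Icc a b t -> continuous f t) ->
  (forall t, Icc a b t -> 0 <= f t) -> RInt f a b <= 0 ->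
  forall t, Icc a b t -> f t = 0.
Proof.
  intros hab hc hp hI t ht.
  destruct (Req_dec (f t) 0) as [|hne]; [assumption|exfalso].
  assert (hft : 0 < f t) by (assert (h := hp t ht); lra).
  destruct (hc t ht _ (locally_ball (f t) (mkposreal _ hft))) as [d hd].
  assert (hpos : forall s, Rabs (s - t) < d -> 0 < f s).
  { intros s hs. assert (h : Rabs (f s - f t) < f t) by exact (hd s hs).
    apply Rabs_def2 in h. lra. }
  assert (hd0 := cond_pos d). destruct ht as [ht1 ht2].
  (* Truncating at [a] and [b] keeps the subinterval nondegenerate even when [t] is an endpoint. *)
  set (u := Rmax a (t - d / 2)). set (v := Rmin b (t + d / 2)).
  assert (hu1 : a <= u) by apply Rmax_l.
  assert (hu2 : t - d / 2 <= u) by apply Rmax_r.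
  assert (hv1 : v <= b) by apply Rmin_l.
  assert (hv2 : v <= t + d / 2) by apply Rmin_r.
  assert (huv : u < v).
  { unfold u, v. apply Rmax_lub_lt; apply Rmin_glb_lt; lra. }
  assert (hi : forall x y, a <= x -> x <= y -> y <= b -> ex_RInt f x y).
  { intros x y h1 h2 h3. apply ex_RInt_continuous_le; [exact h2|].
    intros s [hs1 hs2]. apply hc. split; lra. }
  assert (hn : forall x y, a <= x -> x <= y -> y <= b -> 0 <= RInt f x y).
  { intros x y h1 h2 h3. apply RInt_ge_0; [exact h2|now apply hi|].
    intros s hs. apply hp. split; lra. }
  assert (hm : 0 < RInt f u v).
  { apply RInt_gt_0; [exact huv| |].
    - intros s hs. apply hpos. apply Rabs_def1; lra.
    - intros s hs. apply hc. split; lra. }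
  assert (e1 : RInt f a u + RInt f u b = RInt f a b).
  { apply (RInt_Chasles (V := R_CompleteNormedModule)); apply hi; lra. }
  assert (e2 : RInt f u v + RInt f v b = RInt f u b).
  { apply (RInt_Chasles (V := R_CompleteNormedModule)); apply hi; lra. }
  assert (h1 := hn a u ltac:(lra) ltac:(lra) ltac:(lra)).
  assert (h2 := hn v b ltac:(lra) ltac:(lra) ltac:(lra)).
  lra.
Qed.

(** * Positivity of the quadratic form *)

Lemma wirtinger (a b k : R) (H H' : R -> R) :
  a < b -> 0 <= k -> k * (b - a) < PI ->
  (forall t, Icc a b t -> is_derive H t (H' t)) ->
  (forall t, Icc a b t -> continuous H' t) ->
  H a = 0 -> H b = 0 ->
  0 <= RInt (fun t => H' t ^ 2 - k ^ 2 * H t ^ 2) a b /\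
  (RInt (fun t => H' t ^ 2 - k ^ 2 * H t ^ 2) a b <= 0 ->
   forall t, Icc a b t -> H t = 0).
Proof.
  intros hab hk hkPI hH hH' ha hb.
  (* Centring at the midpoint keeps [u] strictly between [- PI / 2] and [PI / 2], so the cosine
     stays positive. *)
  set (u := fun t => k * (t - (a + b) / 2)).
  set (w := fun t => - k * (sin (u t) / cos (u t))).
  assert (hu : forall t, is_derive u t k).
  { intros t. unfold u. auto_derive; [trivial|ring]. }
  assert (hcos : forall t, Icc a b t -> 0 < cos (u t)).
  { intros t [h1 h2]. unfold u. apply cos_gt_0; nra. }
  (* This is the Riccati equation attached to [H'' + k ^ 2 * H = 0]. *)
  assert (hw : forall t, Icc a b t -> is_derive w t (- (k ^ 2 + w t ^ 2))).
  { intros t ht. specialize (hcos t ht). specialize (hu t). unfold w.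
    clearbody u. auto_derive.
    { repeat split; try (exists k; exact hu). lra. }
    rewrite (Derive_eta_unique u t k hu).
    field. lra. }
  assert (hw2 : forall t, Icc a b t -> continuous w t).
  { intros t ht. exact (is_derive_continuous _ _ _ (hw t ht)). }
  set (g := fun t => (H' t - w t * H t) ^ 2).
  assert (hg : forall t, Icc a b t -> continuous g t).
  { intros t ht. specialize (hH t ht). specialize (hH' t ht).
    specialize (hw2 t ht). unfold g. solve_continuous. }
  (* [r] is the derivative of [w * H ^ 2], with the Riccati equation substituted. Its integral
     vanishes by the boundary values, and [g + r] is the original integrand. *)
  set (r := fun t => - (k ^ 2 + w t ^ 2) * H t ^ 2 + w t * (2 * H t * H' t)).
  assert (hr : forall t, Icc a b t -> continuous r t).
  { intros t ht. specialize (hH t ht). specialize (hH' t ht).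
    specialize (hw2 t ht). unfold r. solve_continuous. }
  assert (hr0 : RInt r a b = 0 :> R).
  { rewrite (RInt_is_derive (fun t => w t * H t ^ 2) r);
      [rewrite ha, hb; ring|lra| |exact hr].
    intros t ht. specialize (hH t ht). specialize (hw t ht). unfold r.
    evar_last.
    { apply (is_derive_mult w (fun t => H t ^ 2)); [exact hw| |apply Rmult_comm].
      apply (is_derive_pow H 2); exact hH. }
    unfold plus, mult; simpl. ring. }
  assert (hid : RInt (fun t => H' t ^ 2 - k ^ 2 * H t ^ 2) a b = RInt g a b).
  { rewrite (RInt_ext _ (fun t => plus (g t) (r t))).
    2: { intros t _. unfold g, r, plus; simpl. ring. }
    rewrite (RInt_plus (V := R_CompleteNormedModule) g r);
      [|apply ex_RInt_continuous_le; [lra|assumption]..].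
    rewrite hr0. apply Rplus_0_r. }
  rewrite hid. split.
  - apply RInt_ge_0; [lra|apply ex_RInt_continuous_le; [lra|exact hg]|].
    intros t _. apply pow2_ge_0.
  - intros hle.
    assert (hz : forall t, Icc a b t -> g t = 0).
    { apply RInt_nonneg_eq_0; try assumption. intros t _. apply pow2_ge_0. }
    intros t [ht1 ht2].
    destruct (Req_dec a t) as [<-|hne]; [exact ha|].
    (* [H' = w H] says that [H / cos u] is constant. *)
    assert (he : H a / cos (u a) = H t / cos (u t)).
    { apply (eq_is_derive (V := R_NormedModule) (fun s => H s / cos (u s)));
        [|lra].
      intros s hs. assert (hs' : Icc a b s) by (split; lra).
      specialize (hcos s hs'). specialize (hz s hs').
      unfold g in hz.
      assert (hz' : H' s = w s * H s) by nra.
      evar_last.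
      { apply (is_derive_div H (fun s => cos (u s)) s (H' s) (- k * sin (u s)));
          [exact (hH s hs')| |lra].
        specialize (hu s). clearbody u. auto_derive.
        { exists k. exact hu. }
        rewrite (Derive_eta_unique u s k hu). ring. }
      rewrite hz'. unfold w, zero; simpl. field. lra. }
    rewrite ha in he. unfold Rdiv at 1 in he. rewrite Rmult_0_l in he.
    specialize (hcos t (conj ht1 ht2)).
    replace (H t) with (H t / cos (u t) * cos (u t)) by (field; lra).
    rewrite <- he. ring.
Qed.

(** The integrand dominates [m * (H' ^ 2 - k ^ 2 * H ^ 2)] pointwise; since [m] is positive, both
    conclusions of [wirtinger] carry over. *)
Lemma quadratic_form_positive (a b k m : R) (E q H H' : R -> R) :
  a < b -> 0 <= k -> k * (b - a) < PI -> 0 < m ->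
  (forall t, Icc a b t -> m <= E t) ->
  (forall t, Icc a b t -> - (m * k ^ 2) <= q t) ->
  (forall t, Icc a b t -> continuous E t) ->
  (forall t, Icc a b t -> continuous q t) ->
  (forall t, Icc a b t -> is_derive H t (H' t)) ->
  (forall t, Icc a b t -> continuous H' t) ->
  H a = 0 -> H b = 0 ->
  0 <= RInt (fun t => E t * H' t ^ 2 + q t * H t ^ 2) a b /\
  (RInt (fun t => E t * H' t ^ 2 + q t * H t ^ 2) a b <= 0 ->
   forall t, Icc a b t -> H t = 0).
Proof.
  intros hab hk hkPI hm hE hq cE cq hH cH' ha hb.
  destruct (wirtinger a b k H H' hab hk hkPI hH cH' ha hb) as [hpos hzero].
  assert (hi : ex_RInt (fun t => H' t ^ 2 - k ^ 2 * H t ^ 2) a b).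
  { apply ex_RInt_continuous_le; [lra|]. intros t ht.
    specialize (hH t ht). specialize (cH' t ht). solve_continuous. }
  assert (hle : m * RInt (fun t => H' t ^ 2 - k ^ 2 * H t ^ 2) a b
                <= RInt (fun t => E t * H' t ^ 2 + q t * H t ^ 2) a b).
  { change (scal m (RInt (fun t => H' t ^ 2 - k ^ 2 * H t ^ 2) a b)
            <= RInt (fun t => E t * H' t ^ 2 + q t * H t ^ 2) a b).
    rewrite <- (RInt_scal (V := R_CompleteNormedModule)) by exact hi.
    apply RInt_le; [lra| | |].
    - apply (ex_RInt_scal (V := R_CompleteNormedModule)). exact hi.
    - apply ex_RInt_continuous_le; [lra|]. intros t ht.
      specialize (hH t ht). specialize (cH' t ht). specialize (cE t ht).
      specialize (cq t ht). solve_continuous.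
    - intros t [h1 h2]. assert (ht : Icc a b t) by (split; lra).
      specialize (hE t ht). specialize (hq t ht).
      assert (hs1 := pow2_ge_0 (H t)). assert (hs2 := pow2_ge_0 (H' t)).
      unfold scal; simpl; unfold mult; simpl. simpl in hs1, hs2, hq. nra. }
  split; [nra|]. intros h0. apply hzero. nra.
Qed.

(** * Comparison of an extremal with its competitors *)

(** The combination [LY + K - LZ] is an exact derivative: the terms linear in [Y - Z] are absorbed
    by the Euler-Lagrange equation, and the primitive vanishes at both ends because [Y] and [Z]
    agree there. *)
Lemma action_decomposition (a b : R) (Th Th' E Z P Y Y' : R -> R) :
  a < b ->
  (forall t, Icc a b t -> is_derive Th t (Th' t)) ->
  (forall t, Icc a b t -> continuous Th' t) ->
  (forall t, Icc a b t -> continuous E t) ->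
  (forall t, Icc a b t -> is_derive Z t (P t)) ->
  (forall t, Icc a b t -> continuous P t) ->
  (forall t, Icc a b t ->
     is_derive (fun s => E s * P s) t (Th' t * Z t / 2)) ->
  (forall t, Icc a b t -> is_derive Y t (Y' t)) ->
  (forall t, Icc a b t -> continuous Y' t) ->
  Y a = Z a -> Y b = Z b ->
  RInt (fun t => Th t * P t * Z t - E t * P t ^ 2) a b =
  RInt (fun t => Th t * Y' t * Y t - E t * Y' t ^ 2) a b +
  RInt (fun t => E t * (Y' t - P t) ^ 2 + Th' t / 2 * (Y t - Z t) ^ 2) a b.
Proof.
  intros hab hTh cTh' cE hZ cP hEP hY cY' ha hb.
  set (LZ := fun t => Th t * P t * Z t - E t * P t ^ 2).
  set (LY := fun t => Th t * Y' t * Y t - E t * Y' t ^ 2).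
  set (K := fun t => E t * (Y' t - P t) ^ 2 + Th' t / 2 * (Y t - Z t) ^ 2).
  assert (cLZ : forall t, Icc a b t -> continuous LZ t).
  { intros t ht. specialize (hTh t ht). specialize (cE t ht). specialize (hZ t ht).
    specialize (cP t ht). unfold LZ. solve_continuous. }
  assert (cLY : forall t, Icc a b t -> continuous LY t).
  { intros t ht. specialize (hTh t ht). specialize (cE t ht). specialize (hY t ht).
    specialize (cY' t ht). unfold LY. solve_continuous. }
  assert (cK : forall t, Icc a b t -> continuous K t).
  { intros t ht. specialize (cTh' t ht). specialize (cE t ht). specialize (hZ t ht).
    specialize (cP t ht). specialize (hY t ht). specialize (cY' t ht).
    unfold K. solve_continuous. }
  assert (h0 : RInt (fun t => LY t + K t - LZ t) a b = 0 :> R).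
  { rewrite (RInt_is_derive
      (fun t => Th t / 2 * (Y t ^ 2 - Z t ^ 2) - 2 * (E t * P t) * (Y t - Z t))).
    - rewrite ha, hb. ring.
    - lra.
    - intros t ht. specialize (hTh t ht). specialize (hZ t ht).
      specialize (hEP t ht). specialize (hY t ht).
      (* The product is differentiated as a single function, since the hypotheses give a derivative
         for [E * P] and not for its factors. *)
      set (N := fun s => E s * P s) in hEP.
      apply (is_derive_ext
        (fun t => Th t / 2 * (Y t ^ 2 - Z t ^ 2) - 2 * N t * (Y t - Z t))).
      { reflexivity. }
      auto_derive.
      { repeat split; eexists; eassumption. }
      rewrite (Derive_eta_unique Th t _ hTh),
        (Derive_eta_unique Z t _ hZ),
        (Derive_eta_unique Y t _ hY),
        (Derive_eta_unique N t _ hEP).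
      unfold LY, LZ, K, N. field.
    - intros t ht. specialize (cLY t ht). specialize (cLZ t ht).
      specialize (cK t ht). solve_continuous. }
  assert (iY := ex_RInt_continuous_le LY a b (Rlt_le _ _ hab) cLY).
  assert (iZ := ex_RInt_continuous_le LZ a b (Rlt_le _ _ hab) cLZ).
  assert (iK := ex_RInt_continuous_le K a b (Rlt_le _ _ hab) cK).
  assert (h1 : RInt (fun t => LY t + K t - LZ t) a b
               = RInt LY a b + RInt K a b - RInt LZ a b).
  { apply is_RInt_unique.
    apply (is_RInt_minus (V := R_NormedModule) (fun t => LY t + K t) LZ).
    - apply (is_RInt_plus (V := R_NormedModule) LY K);
        apply (RInt_correct (V := R_CompleteNormedModule)); assumption.
    - apply (RInt_correct (V := R_CompleteNormedModule)); assumption. }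
  lra.
Qed.

Lemma J_eq_RInt (T : R) (theta eta y Th E Y Y' : R -> R) :
  0 < T ->
  (forall t, Icc 0 T t -> Th t = theta t) ->
  (forall t, Icc 0 T t -> E t = eta t) ->
  (forall t, Icc 0 T t -> Y t = y t) ->
  (forall t, Icc 0 T t -> Y' t = Derive_on 0 T y t) ->
  J T theta eta y = RInt (fun t => Th t * Y' t * Y t - E t * Y' t ^ 2) 0 T.
Proof.
  intros hT h1 h2 h3 h4. apply (RInt_ext (V := R_CompleteNormedModule)).
  intros t. rewrite Rmin_left, Rmax_right by lra. intros ht.
  assert (ht' : Icc 0 T t) by (split; lra).
  now rewrite h1, h2, h3, h4.
Qed.

(** * Sign changes of the derivative *)

Lemma one_turning_point_or_decreasing (T : R) (z Z P E : R -> R) :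
  0 < T ->
  (forall t, Icc 0 T t -> Z t = z t) ->
  (forall t, Icc 0 T t -> P t = Derive_on 0 T z t) ->
  (forall t, Icc 0 T t -> is_derive Z t (P t)) ->
  (forall t, Icc 0 T t -> 0 < E t) ->
  decreasing_on 0 T (fun t => E t * P t) ->
  z T < z 0 ->
  decreasing_on 0 T z \/ one_turning_point 0 T z.
Proof.
  intros hT eZ eP hZ hE hdec hz.
  (* [E * P] has the sign of [P] and is decreasing, so a negative sign persists. *)
  assert (key : forall s t, Icc 0 T s -> Icc 0 T t -> s <= t -> P s < 0 -> P t < 0).
  { intros s t hs ht hst hP. assert (h := hdec s t hs ht hst). simpl in h.
    assert (h1 := hE s hs). assert (h2 := hE t ht). nra. }
  destruct (Classical_Prop.classic (exists s, Icc 0 T s /\ 0 < P s))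
    as [(s & hs & hPs)|hno].
  - right. split.
    + destruct (Classical_Prop.classic (exists t, Icc 0 T t /\ P t < 0))
        as [(t & ht & hPt)|hno].
      * exists s, t. rewrite <- !eP by assumption.
        destruct (Rlt_dec s t) as [hst|hst].
        { repeat split; try apply hs; try apply ht; [assumption|nra]. }
        assert (h := key t s ht hs ltac:(lra) hPt). lra.
      (* Without a negative value of [P], [Z] would be increasing, against [z T < z 0]. *)
      * exfalso.
        assert (h : decreasing_on 0 T (fun t => - Z t)).
        { apply (decreasing_on_is_derive _ _ _ (fun t => - P t)).
          - intros t ht. exact (is_derive_opp (V := R_NormedModule) Z t _ (hZ t ht)).
          - intros t ht. destruct (Rlt_dec (P t) 0); [|lra].
            exfalso. apply hno. now exists t. }
        assert (i0 : Icc 0 T 0) by (split; lra).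
        assert (iT : Icc 0 T T) by (split; lra).
        assert (h' := h 0 T i0 iT ltac:(lra)). simpl in h'.
        rewrite !eZ in h' by assumption. lra.
    (* By [key], [P t] is negative whichever sign [P r] has. If [P r] is negative, the first product
       is positive; otherwise [P v] is negative and the second one is. *)
    + intros (r & t & v & hr & ht & hv & [hrt htv] & h1 & h2).
      rewrite <- !eP in h1, h2 by assumption.
      destruct (Rlt_dec (P r) 0) as [hn|hn].
      * assert (h := key r t hr ht ltac:(lra) hn). nra.
      * assert (h := key t v ht hv ltac:(lra) ltac:(nra)). nra.
  - left. intros s t hs ht hst. rewrite <- !eZ by assumption.
    apply (decreasing_on_is_derive 0 T Z P hZ); try assumption.
    intros r hr. destruct (Rlt_dec 0 (P r)); [|lra].
    exfalso. apply hno. now exists r.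
Qed.

(** * Optimality, sign and shape of the boundary value solution *)

Theorem proposition17 (T Q : R) (theta eta : R -> R)
    (etabar thetabar gamma : R)
    (hT : 0 < T) (hQ : 0 < Q)
    (theta_pos : forall t, Icc 0 T t -> 0 < theta t)
    (eta_pos : forall t, Icc 0 T t -> 0 < eta t)
    (theta_C1 : C1_on 0 T theta) (eta_C1 : C1_on 0 T eta)
    (theta_decr : decreasing_on 0 T theta)
    (eta_incr : increasing_on 0 T eta)
    (etabar_min : is_min_on 0 T eta etabar)
    (thetabar_max :
       is_max_on 0 T (fun t => Rmax (- Derive_on 0 T theta t) 0) thetabar)
    (gamma_def : gamma = thetabar / (2 * etabar))
    (hgamma : sqrt gamma * T < PI)
    (hBVP : exists z, unique_solution_on 0 T (solves_BVP T Q theta eta) z) :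
  exists z, unique_solution_on 0 T (solves_execution T Q theta eta) z /\
    (forall t, Icc 0 T t -> 0 <= z t) /\
    (decreasing_on 0 T z \/ one_turning_point 0 T z).
Proof.
  destruct hBVP as [z [(hzC2 & hode & hz0 & hzT) _]]. exists z.
  assert (i0 : Icc 0 T 0) by (split; lra).
  assert (iT : Icc 0 T T) by (split; lra).
  destruct (C1_on_extension 0 T theta hT theta_C1) as (Th & Th' & hTh).
  destruct (C1_on_extension 0 T eta hT eta_C1) as (E & E' & hE).
  destruct (C1_on_extension 0 T z hT (proj1 hzC2)) as (Z & D & hZ).
  destruct (C1_on_extension 0 T _ hT (proj2 hzC2)) as (P & P' & hP).
  (* [D] and [P] both extend the derivative of [z]; [P] is the one that is itself differentiable. *)
  assert (dZ : forall t, Icc 0 T t -> is_derive Z t (P t)).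
  { intros t ht. destruct (hZ t ht) as (_ & e1 & h & _).
    destruct (hP t ht) as (e2 & _). rewrite e2, <- e1. exact h. }
  assert (cP : forall t, Icc 0 T t -> continuous P t).
  { intros t ht. apply (is_derive_continuous P t (P' t)), hP, ht. }
  assert (cE : forall t, Icc 0 T t -> continuous E t).
  { intros t ht. apply (is_derive_continuous E t (E' t)), hE, ht. }
  assert (cTh' : forall t, Icc 0 T t -> continuous (fun s => Th' s / 2) t).
  { intros t ht. destruct (hTh t ht) as (_ & _ & _ & h). solve_continuous. }
  (* The differential equation in divergence form. *)
  assert (flux : forall t, Icc 0 T t ->
            is_derive (fun s => E s * P s) t (Th' t * Z t / 2)).
  { intros t ht. destruct (hE t ht) as (e1 & e2 & h1 & _).
    destruct (hP t ht) as (e3 & e4 & h2 & _).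
    destruct (hTh t ht) as (_ & e5 & _ & _). destruct (hZ t ht) as (e6 & _).
    assert (h := hode t ht). rewrite <- e1, <- e2, <- e3, <- e4, <- e5, <- e6 in h.
    evar_last.
    { apply (is_derive_mult E P); [exact h1|exact h2|apply Rmult_comm]. }
    unfold plus, mult; simpl. lra. }
  assert (hTh'0 : forall t, Icc 0 T t -> Th' t <= 0).
  { intros t ht. destruct (hTh t ht) as (_ & -> & _).
    apply Derive_on_decreasing_le; try assumption. exact (proj1 theta_C1 t ht). }
  destruct etabar_min as [(tm & htm & htm') hmin].
  assert (hm : 0 < etabar) by (rewrite <- htm'; now apply eta_pos).
  assert (hEm : forall t, Icc 0 T t -> etabar <= E t).
  { intros t ht. destruct (hE t ht) as (-> & _). now apply hmin. }
  assert (hgamma0 : 0 <= gamma).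
  { destruct thetabar_max as [(t & _ & <-) _]. rewrite gamma_def.
    apply Rdiv_le_0_compat; [apply Rmax_r|lra]. }
  assert (hq : forall t, Icc 0 T t -> - (etabar * sqrt gamma ^ 2) <= Th' t / 2).
  { intros t ht. rewrite pow2_sqrt by exact hgamma0.
    replace (etabar * gamma) with (thetabar / 2) by (rewrite gamma_def; field; lra).
    destruct (hTh t ht) as (_ & -> & _).
    assert (h1 := proj2 thetabar_max t ht). simpl in h1.
    assert (h2 := Rmax_l (- Derive_on 0 T theta t) 0). lra. }
  (* The left end is left free: [s = 0] serves optimality, and a zero of [z] serves nonnegativity.
     Shortening the interval preserves the bound by [PI]. *)
  assert (hcoer : forall s H H', 0 <= s < T ->
    (forall t, Icc s T t -> is_derive H t (H' t)) ->
    (forall t, Icc s T t -> continuous H' t) -> H s = 0 -> H T = 0 ->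
    0 <= RInt (fun t => E t * H' t ^ 2 + Th' t / 2 * H t ^ 2) s T /\
    (RInt (fun t => E t * H' t ^ 2 + Th' t / 2 * H t ^ 2) s T <= 0 ->
     forall t, Icc s T t -> H t = 0)).
  { intros s H H' [hs1 hs2] dH cH' hs hHT.
    assert (sub : forall t, Icc s T t -> Icc 0 T t) by (intros t []; split; lra).
    assert (hk := sqrt_pos gamma).
    apply (quadratic_form_positive s T (sqrt gamma) etabar E (fun t => Th' t / 2));
      auto. nra. }
  assert (hnonneg : forall t, Icc 0 T t -> 0 <= z t).
  { intros t ht. destruct (Rle_dec 0 (z t)) as [|hneg]; [assumption|exfalso].
    assert (eZ := proj1 (hZ t ht)). assert (eZ0 := proj1 (hZ 0 i0)).
    assert (eZT := proj1 (hZ T iT)).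
    assert (hzero : exists s, 0 <= s <= t /\ Z s = 0).
    { destruct ht as [ht0 htT].
      (* The sign is flipped because this form of the intermediate value theorem goes from negative
         to positive values. *)
      destruct (Ranalysis5.IVT_interv (fun s => - Z s) 0 t) as (s & hs & e).
      - intros s hs. apply continuity_pt_opp, continuity_pt_filterlim.
        apply (is_derive_continuous Z s (P s)), dZ. split; lra.
      - destruct (Req_dec 0 t) as [e|]; [subst t|]; lra.
      - lra.
      - lra.
      - exists s. lra. }
    destruct hzero as (s & hs & hZs).
    assert (hsT : 0 <= s < T).
    { split; [lra|]. destruct ht as [ht0 htT].
      destruct (Req_dec t T) as [->|]; lra. }
    assert (sub : forall t, Icc s T t -> Icc 0 T t) by (intros r []; split; lra).
    destruct (hcoer s Z P hsT) as [_ h]; auto; [congruence|].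
    assert (hZt : Z t = 0); [|lra]. destruct ht as [ht0 htT].
    apply h; [|split; lra].
    (* By [flux], the form evaluated at [Z] itself integrates to the boundary terms of [E * P * Z],
       which vanish at [s] and [T]. Hence [Z] is zero on the whole of [Icc s T], contradicting
       [z t < 0]. *)
    rewrite (RInt_is_derive (fun r => (E r * P r) * Z r)).
    - rewrite hZs, eZT, hzT. lra.
    - lra.
    - intros r hr. apply sub in hr. evar_last.
      { apply (is_derive_mult (fun r => E r * P r) Z);
          [exact (flux r hr)|exact (dZ r hr)|apply Rmult_comm]. }
      unfold plus, mult; simpl. field.
    - intros r hr. apply sub in hr. specialize (cE r hr). specialize (cP r hr).
      specialize (cTh' r hr). specialize (dZ r hr). solve_continuous. }
  assert (hJ : forall y, Xi T Q y ->
    J T theta eta y <= J T theta eta z /\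
    (J T theta eta z <= J T theta eta y -> forall t, Icc 0 T t -> y t = z t)).
  { intros y (hyC2 & hy0 & hyT).
    destruct (C1_on_extension 0 T y hT (proj1 hyC2)) as (Y & Y' & hY).
    rewrite (J_eq_RInt T theta eta y Th E Y Y'), (J_eq_RInt T theta eta z Th E Z P);
      try assumption;
      try (intros t ht; solve [apply hTh, ht|apply hE, ht|apply hY, ht
                              |apply hZ, ht|apply hP, ht]).
    assert (e0 : Y 0 = Z 0).
    { rewrite (proj1 (hY 0 i0)), (proj1 (hZ 0 i0)). congruence. }
    assert (eT : Y T = Z T).
    { rewrite (proj1 (hY T iT)), (proj1 (hZ T iT)). congruence. }
    rewrite (action_decomposition 0 T Th Th' E Z P Y Y'); try assumption;
      try (intros t ht; solve [apply hTh, ht|apply hY, ht]).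
    (* The gap between the two actions is the form at [Y - Z]: its sign gives optimality, and its
       vanishing gives uniqueness. *)
    destruct (hcoer 0 (fun t => Y t - Z t) (fun t => Y' t - P t)) as [h1 h2].
    - lra.
    - intros t ht. apply (is_derive_minus (V := R_NormedModule) Y Z);
        [apply hY, ht|apply dZ, ht].
    - intros t ht. apply (continuous_minus (V := R_NormedModule) Y' P); [apply hY, ht|apply cP, ht].
    - lra.
    - lra.
    - split; [lra|]. intros hle t ht.
      assert (h := h2 ltac:(lra) t ht). simpl in h.
      destruct (hY t ht) as (<- & _). destruct (hZ t ht) as (<- & _). lra. }
  assert (hzXi : Xi T Q z) by (split; [exact hzC2|split; assumption]).
  split; [split; [split; [exact hzXi|]|]|split; [exact hnonneg|]].
  - intros y hy. apply hJ, hy.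
  - intros y [hy hopt]. apply hJ; [exact hy|]. now apply hopt.
  - apply (one_turning_point_or_decreasing T z Z P E hT).
    + intros t ht. apply hZ, ht.
    + intros t ht. apply hP, ht.
    + exact dZ.
    + intros t ht. specialize (hEm t ht). lra.
    + apply (decreasing_on_is_derive _ _ _ (fun t => Th' t * Z t / 2) flux).
      intros t ht. specialize (hTh'0 t ht). specialize (hnonneg t ht).
      rewrite (proj1 (hZ t ht)). nra.
    + lra.
Qed.
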